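(* Let $X$ be any set and consider the $C$-algebra $\mathbb{3}^{X}$. Then the set of atoms of $\mathbb{3}^{X}$ is $$\mathscr{A}(\mathbb{3}^{X}) = \{ \alpha \in \mathbb{3}^{X} : \text{there exists a unique } x_{o} \in X \text{ such that } \alpha(x_{o}) \in \{T, U\} \}.$$
   Context: $\mathbb{3}$ denotes McCarthy's three-valued $C$-algebra on $\{T,F,U\}$ with operations: $\neg T = F$, $\neg F = T$, $\neg U = U$; $T\wedge x = x$, $F \wedge x = F$, $U \wedge x = U$ for all $x$; $T \vee x = T$, $F \vee x = x$, $U \vee x = U$ for all $x$. $\mathbb{3}^{X}$ is the set of functions $X \to \mathbb{3}$ with operations defined pointwise; its constants are $\mathbf{T},\mathbf{F},\mathbf{U}$ (the constant functions). On a $C$-algebra $M$ with constants $T,F,U$, the partial order is $a \leq b$ iff $a \vee b = b$. An element $a \neq F$ is an atom if for every $b$ with $F \leq b \leq a$ and $b \neq a$ we have $b = F$; $\mathscr{A}(M)$ denotes the set of atoms. *)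

(* Defs.v *)
From HB Require Import structures.
From mathcomp Require Import ssreflect ssrfun ssrbool.
From mathcomp Require Import boolp classical_sets.

Set Implicit Arguments.
Unset Strict Implicit.
Unset Printing Implicit Defensive.

Declare Scope calg_scope.
Delimit Scope calg_scope with C.

(* C-algebras in the sense of Guzman and Squier, with the three constants:
   T is the identity of meet, F the identity of join, and U is fixed by
   negation.  Neither meet nor join is commutative. *)
HB.mixin Record isCAlgebra M := {
  cneg : M -> M;
  cand : M -> M -> M;
  cor  : M -> M -> M;
  cT : M;
  cF : M;
  cU : M;
  cnegK : forall x, cneg (cneg x) = x;
  cneg_and : forall x y, cneg (cand x y) = cor (cneg x) (cneg y);
  candA : forall x y z, cand (cand x y) z = cand x (cand y z);
  cand_orr : forall x y z, cand x (cor y z) = cor (cand x y) (cand x z);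
  cand_orl : forall x y z,
    cand (cor x y) z = cor (cand x z) (cand (cneg x) (cand y z));
  cor_andK : forall x y, cor x (cand x y) = x;
  cor_and_comm : forall x y,
    cor (cand x y) (cand y x) = cor (cand y x) (cand x y);
  candTx : forall x, cand cT x = x;
  candxT : forall x, cand x cT = x;
  corFx : forall x, cor cF x = x;
  corxF : forall x, cor x cF = x;
  cnegU : cneg cU = cU
}.

#[short(type="cAlgebraType")]
HB.structure Definition CAlgebra := { M of isCAlgebra M }.

Arguments cT {_}.
Arguments cF {_}.
Arguments cU {_}.

Definition cle (M : cAlgebraType) (a b : M) : Prop := cor a b = b.

Notation "a <= b" := (cle a b) : calg_scope.

Definition is_atom (M : cAlgebraType) (a : M) : Prop :=
  a <> cF /\
  forall b : M, (cF <= b)%C -> (b <= a)%C -> b <> a -> b = cF.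

Definition atoms (M : cAlgebraType) : set M := [set a | is_atom a]%classic.

Arguments atoms M : clear implicits.

Variant three := T3 | F3 | U3.

Definition neg3 (x : three) : three :=
  match x with T3 => F3 | F3 => T3 | U3 => U3 end.

Definition and3 (x y : three) : three :=
  match x with T3 => y | F3 => F3 | U3 => U3 end.

Definition or3 (x y : three) : three :=
  match x with T3 => T3 | F3 => y | U3 => U3 end.

Lemma neg3K : forall x, neg3 (neg3 x) = x.
Proof. by move=> x; case: x. Qed.

Lemma neg3_and : forall x y, neg3 (and3 x y) = or3 (neg3 x) (neg3 y).
Proof. by move=> x y; case: x; case: y. Qed.

Lemma and3A : forall x y z, and3 (and3 x y) z = and3 x (and3 y z).
Proof. by move=> x y z; case: x; case: y; case: z. Qed.

Lemma and3_orr : forall x y z, and3 x (or3 y z) = or3 (and3 x y) (and3 x z).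
Proof. by move=> x y z; case: x; case: y; case: z. Qed.

Lemma and3_orl : forall x y z,
  and3 (or3 x y) z = or3 (and3 x z) (and3 (neg3 x) (and3 y z)).
Proof. by move=> x y z; case: x; case: y; case: z. Qed.

Lemma or3_andK : forall x y, or3 x (and3 x y) = x.
Proof. by move=> x y; case: x; case: y. Qed.

Lemma or3_and_comm : forall x y,
  or3 (and3 x y) (and3 y x) = or3 (and3 y x) (and3 x y).
Proof. by move=> x y; case: x; case: y. Qed.

Lemma and3Tx : forall x, and3 T3 x = x.
Proof. by move=> x; case: x. Qed.

Lemma and3xT : forall x, and3 x T3 = x.
Proof. by move=> x; case: x. Qed.

Lemma or3Fx : forall x, or3 F3 x = x.
Proof. by move=> x; case: x. Qed.

Lemma or3xF : forall x, or3 x F3 = x.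
Proof. by move=> x; case: x. Qed.

Lemma neg3U : neg3 U3 = U3.
Proof. by []. Qed.

HB.instance Definition _ := isCAlgebra.Build three
  neg3K neg3_and and3A and3_orr and3_orl or3_andK
  or3_and_comm and3Tx and3xT or3Fx or3xF neg3U.

Section Pointwise.
Variables (X : Type) (M : cAlgebraType).
Implicit Types f g : X -> M.

Definition fun_neg f : X -> M := fun x => cneg (f x).
Definition fun_and f g : X -> M := fun x => cand (f x) (g x).
Definition fun_or f g : X -> M := fun x => cor (f x) (g x).
Definition fun_T : X -> M := fun=> cT.
Definition fun_F : X -> M := fun=> cF.
Definition fun_U : X -> M := fun=> cU.

Lemma fun_negK : forall f, fun_neg (fun_neg f) = f.
Proof. by move=> *; apply: funext => x; exact: cnegK. Qed.

Lemma fun_neg_and : forall f g,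
  fun_neg (fun_and f g) = fun_or (fun_neg f) (fun_neg g).
Proof. by move=> *; apply: funext => x; exact: cneg_and. Qed.

Lemma fun_andA : forall f g h,
  fun_and (fun_and f g) h = fun_and f (fun_and g h).
Proof. by move=> *; apply: funext => x; exact: candA. Qed.

Lemma fun_and_orr : forall f g h,
  fun_and f (fun_or g h) = fun_or (fun_and f g) (fun_and f h).
Proof. by move=> *; apply: funext => x; exact: cand_orr. Qed.

Lemma fun_and_orl : forall f g h,
  fun_and (fun_or f g) h =
  fun_or (fun_and f h) (fun_and (fun_neg f) (fun_and g h)).
Proof. by move=> *; apply: funext => x; exact: cand_orl. Qed.

Lemma fun_or_andK : forall f g, fun_or f (fun_and f g) = f.
Proof. by move=> *; apply: funext => x; exact: cor_andK. Qed.

Lemma fun_or_and_comm : forall f g,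
  fun_or (fun_and f g) (fun_and g f) = fun_or (fun_and g f) (fun_and f g).
Proof. by move=> *; apply: funext => x; exact: cor_and_comm. Qed.

Lemma fun_andTx : forall f, fun_and fun_T f = f.
Proof. by move=> *; apply: funext => x; exact: candTx. Qed.

Lemma fun_andxT : forall f, fun_and f fun_T = f.
Proof. by move=> *; apply: funext => x; exact: candxT. Qed.

Lemma fun_orFx : forall f, fun_or fun_F f = f.
Proof. by move=> *; apply: funext => x; exact: corFx. Qed.

Lemma fun_orxF : forall f, fun_or f fun_F = f.
Proof. by move=> *; apply: funext => x; exact: corxF. Qed.

Lemma fun_negU : fun_neg fun_U = fun_U.
Proof. by move=> *; apply: funext => x; exact: cnegU. Qed.

HB.instance Definition _ := isCAlgebra.Build (X -> M)
  fun_negK fun_neg_and fun_andA fun_and_orr fun_and_orl fun_or_andK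
  fun_or_and_comm fun_andTx fun_andxT fun_orFx fun_orxF fun_negU.

End Pointwise.

(* Main.v *)
(* The order on [three] is flat with bottom [F3], so in the pointwise order
   [b <= a] means that [b] arises from [a] by resetting some coordinates to
   [F3]: the atoms are the functions that differ from [F3] at one point. *)
Require Import Defs.
From mathcomp Require Import classical_sets.
From mathcomp Require Import ssreflect ssrfun ssrbool boolp.

Local Open Scope classical_set_scope.

Lemma set_TU_neqF (x : three) : [set T3; U3] x <-> x <> F3.
Proof. by split=> [[] ->|] //; case: x => // _; [left|right]. Qed.

Lemma cle_three (x y : three) : (x <= y)%C <-> x = F3 \/ x = y.
Proof. by split=> [|[] ->]; case: x; case: y => //; (by left) || (by right). Qed.

Lemma cle_pointwise (X : Type) (M : cAlgebraType) (f g : X -> M) :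
  (f <= g)%C <-> forall x, (f x <= g x)%C.
Proof.
by split=> [fg x|fg]; [exact: (congr1 (fun h => h x) fg)|apply: funext].
Qed.

Theorem theorem2p30 (X : Type) :
  atoms (X -> three) =
  [set alpha : X -> three | exists! x0 : X, [set T3; U3] (alpha x0)].
Proof.
apply/seteqP; split=> a /=.
- move=> [a_neqF a_min].
  have [x0 ax0] : exists x, a x <> F3.
    by apply: contrapT => /forallNP aF; apply: a_neqF; apply: funext => x;
       apply: contrapT; exact: aF.
  exists x0; split=> [|x /set_TU_neqF ax]; first exact/set_TU_neqF.
  (* Truncating [a] to the single point [x0] gives a nonzero element below [a]. Minimality makes it
     [a] itself, so [a] is [F3] away from [x0]. *)
  pose b y := if pselect (y = x0) then a y else F3.
  have b_le_a : (b <= a)%C.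
    apply/cle_pointwise => y; apply/cle_three.
    by rewrite /b; case: pselect => ?; [right|left].
  have b_neqF : b <> cF.
    by move=> /(congr1 (fun h => h x0)); rewrite /b; case: pselect.
  (* [corFx b] serves as the proof of [cF <= b], since the order unfolds to an equation on joins. *)
  have ba : b = a by apply: contrapT => /(a_min b (corFx b) b_le_a).
  apply: contrapT => x0x; apply: ax; rewrite -ba /b.
  by case: pselect => // xx0; case: x0x.
- move=> [x0 [/set_TU_neqF ax0 a_uniq]]; split.
    by move=> aF; apply: ax0; rewrite aF.
  move=> b _ /cle_pointwise b_le_a b_neqa.
  have aF x : x <> x0 -> a x = F3.
    by move=> xx0; apply: contrapT => /set_TU_neqF /a_uniq /esym.
  have bF x : x <> x0 -> b x = F3.
    by move=> /aF ax; case/cle_three: (b_le_a x) => // ->.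
  apply: funext => x; have [->|/bF //] := pselect (x = x0).
  (* Off [x0] both functions are [F3], so only [x0] matters: by flatness [b x0] is [F3], as wanted,
     or equals [a x0], which would force [b = a]. *)
  case/cle_three: (b_le_a x0) => // bax0; case: b_neqa; apply: funext => y.
  by have [->//|yx0] := pselect (y = x0); rewrite aF ?bF.
Qed.
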